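(* Let $k\geq 1$ and $n\geq 3$ be integers. If $n\leq 2k+1$, then $\operatorname{sdepth}(S/I(C_n^k))=1$. If $n\geq 2k+2$, then $\operatorname{sdepth}(S/I(C_n^k))\geq\left\lceil\frac{n-k}{2k+1}\right\rceil$.
   Context: $K$ is a field and $S=K[x_1,\dots,x_n]$ is the polynomial ring. $C_n^k$ denotes the $k$-th power of the cycle on the vertex set $\{1,\dots,n\}$ ($n\ge 3$): for $1\le i<j\le n$, $\{i,j\}$ is an edge if and only if $j-i\le k$ or $j-i\ge n-k$ (so $C_n^k$ is the complete graph when $n\le 2k+1$). Its edge ideal $I(C_n^k)\subset S$ is the squarefree monomial ideal generated by all $x_ix_j$ with $\{i,j\}$ an edge of $C_n^k$. Stanley depth: let $M$ be a finitely generated $\mathbb{Z}^n$-graded $S$-module. A Stanley decomposition of $M$ is a presentation of the $K$-vector space $M$ as a finite direct sum $\mathcal{D}: M=\bigoplus_{i=1}^s v_iK[W_i]$, where each $v_i\in M$ is homogeneous, $W_i\subseteq\{x_1,\dots,x_n\}$, $v_iK[W_i]$ is the $K$-subspace generated by all $v_iw$ with $w$ a monomial in $K[W_i]$, and $v_iK[W_i]$ is a free $K[W_i]$-module. Put $\operatorname{sdepth}(\mathcal{D})=\min_i |W_i|$, and $\operatorname{sdepth}(M)=\max\{\operatorname{sdepth}(\mathcal{D}):\mathcal{D}\text{ a Stanley decomposition of }M\}$. *)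

(* Defs.v *)
From HB Require Import structures.
From mathcomp Require Import all_boot all_order all_algebra.
From mathcomp Require Import generic_quotient ring_quotient.
From mathcomp Require Export mpoly.
From mathcomp Require Import boolp.

Set Implicit Arguments.
Unset Strict Implicit.
Unset Printing Implicit Defensive.

Import GRing.Theory.

Local Open Scope ring_scope.
Local Open Scope quotient_scope.

(* Quotients of a commutative ring R by a finitely generated ideal, as
   R-modules. The ring quotient [{ideal_quot I}] is not used because it demands
   a proper ideal and carries no R-module structure. *)
Section IdealQuotient.
Variable R : comNzRingType.

Definition ideal_gen (G : seq R) : {pred R} := fun p =>
  `[< exists c : 'I_(size G) -> R, p = \sum_(i < size G) c i * G`_i >].

Lemma ideal_gen_zmod_closed (G : seq R) : zmod_closed (ideal_gen G).
Proof.
split=> [|p q /asboolP[c ->] /asboolP[d ->]]; apply/asboolP.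
  by exists (fun=> 0); rewrite big1 // => i _; rewrite mul0r.
exists (fun i => c i - d i); rewrite -sumrB.
by apply: eq_bigr => i _; rewrite mulrBl.
Qed.

HB.instance Definition _ (G : seq R) :=
  GRing.isZmodClosed.Build R (ideal_gen G) (ideal_gen_zmod_closed G).

Lemma ideal_genMl (G : seq R) a p : p \in ideal_gen G -> a * p \in ideal_gen G.
Proof.
move=> /asboolP[c ->]; apply/asboolP; exists (fun i => a * c i).
by rewrite mulr_sumr; apply: eq_bigr => i _; rewrite mulrA.
Qed.

Variable G : seq R.

Definition quot_ideal : Type := Quotient.quot (ideal_gen G).

HB.instance Definition _ := GRing.Zmodule.on quot_ideal.

Definition quot_pi (p : R) : quot_ideal := \pi_(Quotient.quot (ideal_gen G)) p.

Definition quot_scale (a : R) (x : quot_ideal) : quot_ideal :=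
  quot_pi (a * repr (x : Quotient.quot (ideal_gen G))).

Lemma quot_pi_eq p q : (quot_pi p == quot_pi q) = (p - q \in ideal_gen G).
Proof. by rewrite Quotient.idealrBE. Qed.

Lemma quot_piD : {morph quot_pi : p q / p + q}.
Proof. exact: Quotient.pi_add. Qed.

Lemma quot_piP (x : quot_ideal) : exists p, x = quot_pi p.
Proof. by exists (repr (x : Quotient.quot (ideal_gen G))); rewrite /quot_pi reprK. Qed.

Lemma quot_scale_pi a p : quot_scale a (quot_pi p) = quot_pi (a * p).
Proof.
apply/eqP; rewrite /quot_scale quot_pi_eq -mulrBr; apply: ideal_genMl.
by rewrite -quot_pi_eq /quot_pi reprK.
Qed.

Lemma quot_scaleA a b x : quot_scale a (quot_scale b x) = quot_scale (a * b) x.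
Proof. by have [p ->] := quot_piP x; rewrite !quot_scale_pi mulrA. Qed.

Lemma quot_scale1 : left_id 1 quot_scale.
Proof. by move=> x; have [p ->] := quot_piP x; rewrite quot_scale_pi mul1r. Qed.

Lemma quot_scaleDr : right_distributive quot_scale +%R.
Proof.
move=> a x y; have [[p ->] [q ->]] := (quot_piP x, quot_piP y).
by rewrite -quot_piD !quot_scale_pi mulrDr quot_piD.
Qed.

Lemma quot_scaleDl x : {morph quot_scale^~ x : a b / a + b}.
Proof.
move=> a b; have [p ->] := quot_piP x.
by rewrite !quot_scale_pi mulrDl quot_piD.
Qed.

HB.instance Definition _ := GRing.Zmodule_isLmodule.Build R quot_ideal
  quot_scaleA quot_scale1 quot_scaleDr quot_scaleDl.

Lemma scale_quot_pi a p : a *: quot_pi p = quot_pi (a * p).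
Proof. exact: quot_scale_pi. Qed.

Lemma quot_pi0 : quot_pi 0 = 0.
Proof. by apply: (addrI (quot_pi 0)); rewrite -quot_piD !addr0. Qed.

End IdealQuotient.

Section StanleyDepth.
Variables (K : fieldType) (n : nat).
Notation S := {mpoly K[n]}.

Definition multideg (m : 'X_{1..n}) : {ffun 'I_n -> int} :=
  [ffun i => (m i)%:Z].

(* Direct sum decomposition of M into K-subspaces indexed by Z^n, compatible
   with multiplication by monomials. K acts through constant polynomials. *)
Record zn_grading (M : lmodType S) := ZnGrading {
  gr_comp : {ffun 'I_n -> int} -> M -> Prop;
  gr_comp0 : forall a, gr_comp a 0;
  gr_comp_lin : forall a (c : K) x y,
    gr_comp a x -> gr_comp a y -> gr_comp a (c%:MP *: x + y);
  gr_compM : forall a m x,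
    gr_comp a x -> gr_comp (multideg m + a) ('X_[m] *: x);
  gr_span : forall x, exists (s : seq {ffun 'I_n -> int}) (y : _ -> M),
    (forall a, gr_comp a (y a)) /\ x = \sum_(a <- s) y a;
  gr_indep : forall (s : seq {ffun 'I_n -> int}) (y : _ -> M),
    uniq s -> (forall a, gr_comp a (y a)) -> \sum_(a <- s) y a = 0 ->
    forall a, a \in s -> y a = 0 }.

(* K[W] as a subset of S *)
Definition subpoly (W : {set 'I_n}) : {pred S} := fun p =>
  all (fun m : 'X_{1..n} => [forall i, (i \notin W) ==> (m i == 0%N)])
      (msupp p).

Section Decomposition.
Variables (M : lmodType S) (gr : zn_grading M).

Definition homogeneous (v : M) : Prop := exists a, gr_comp gr a v.

(* v K[W]: the K-span of the w *: v, w a monomial of K[W] *)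
Definition stanley_space (v : M) (W : {set 'I_n}) (x : M) : Prop :=
  exists2 p, p \in subpoly W & x = p *: v.

(* N, assumed to be a finitely generated K[W]-submodule of M, has a basis;
   bases of such modules are finite. *)
Definition free_over (W : {set 'I_n}) (N : M -> Prop) : Prop :=
  exists (r : nat) (b : 'I_r -> M),
    (forall i, N (b i)) /\
    forall x, N x -> exists! c : {ffun 'I_r -> S},
      (forall i, c i \in subpoly W) /\ x = \sum_i c i *: b i.

Record stanley_decomposition := StanleyDecomposition {
  sd_size : nat;
  sd_gen : 'I_sd_size -> M;
  sd_vars : 'I_sd_size -> {set 'I_n};
  sd_homogeneous : forall i, homogeneous (sd_gen i);
  sd_free : forall i,
    free_over (sd_vars i) (stanley_space (sd_gen i) (sd_vars i));
  sd_direct : forall x, exists! y : {ffun 'I_sd_size -> M},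
    (forall i, stanley_space (sd_gen i) (sd_vars i) (y i)) /\ x = \sum_i y i }.

(* As #|W| <= n, the neutral element n only matters for the empty
   decomposition, which exists only when M = 0. *)
Definition sdepth_dec (D : stanley_decomposition) : nat :=
  \big[minn/n]_(i < sd_size D) #|sd_vars i|.

(* sdepth_dec D <= n, so this is the maximum over all D; it would be 0 if there
   were no D at all. *)
Definition sdepth : nat :=
  \max_(d < n.+1 | `[< exists D, sdepth_dec D = d >]) d.

End Decomposition.

Section MonomialQuotient.
Variable ms : seq 'X_{1..n}.

Definition monomial_gens : seq S := [seq 'X_[m] | m <- ms].

Lemma mem_monomial_ideal p :
  reflect (forall m, m \in msupp p -> exists2 g, g \in ms & (g <= m)%MM)
          (p \in ideal_gen monomial_gens).
Proof.
have sz : size monomial_gens = size ms by rewrite size_map.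
apply: (iffP (asboolP _)) => [[c ->] m|hp].
  move=> /msupp_sum_le /flattenP[/= s /mapP[i _ ->]].
  have lti : (i < size ms)%N by rewrite -sz.
  rewrite (nth_map 0%MM) //= => hm.
  move: hm; rewrite (perm_mem (msuppMX _ _)) => /mapP[q _ ->].
  by exists (nth 0%MM ms i); [exact: mem_nth | exact: lem_addr].
rewrite [p]mpolyE.
have: {subset msupp p <= msupp p} by [].
elim: {1 3}(msupp p) => [|m s IH] sub.
  by exists (fun=> 0); rewrite big_nil big1 // => i _; rewrite mul0r.
have {IH}/asboolP IH := IH (fun x hx => sub x (mem_behead (s := m :: s) hx)).
apply/asboolP; rewrite big_cons.
apply: (rpredD (S := ideal_gen monomial_gens)); last exact: IH.
have [g gms gm] := hp m (sub m (mem_head _ _)).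
have -> : p@_m *: 'X_[m] = p@_m *: 'X_[m - g] * 'X_[g] :> S.
  by rewrite -scalerAl -mpolyXD submK.
apply: ideal_genMl; apply/asboolP.
have lti : (index g ms < size monomial_gens)%N by rewrite sz index_mem.
exists (fun i => (i == Ordinal lti)%:R).
rewrite (bigD1 (Ordinal lti)) //= eqxx mul1r (nth_map 0%MM) ?index_mem //.
rewrite nth_index // big1 ?addr0 // => i /negPf ->.
by rewrite mul0r.
Qed.

(* The degree a component of S/I is the image of that of S. *)
Definition quot_comp (a : {ffun 'I_n -> int})
    (x : quot_ideal monomial_gens) : Prop :=
  exists2 q : S, (forall m, m \in msupp q -> multideg m = a) &
                 x = quot_pi monomial_gens q.

Lemma quot_comp0 a : quot_comp a 0.
Proof. by exists 0; rewrite ?quot_pi0 // => m; rewrite msupp0. Qed.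

Lemma quot_comp_lin a (c : K) x y :
  quot_comp a x -> quot_comp a y -> quot_comp a (c%:MP *: x + y).
Proof.
move=> [p hp ->] [q hq ->]; exists (c%:MP * p + q); last first.
  by rewrite quot_piD scale_quot_pi.
move=> m /msuppD_le; rewrite mem_cat mul_mpolyC => /orP[/msuppZ_le|]; first exact: hp.
exact: hq.
Qed.

Lemma quot_compM a m x :
  quot_comp a x -> quot_comp (multideg m + a) ('X_[m] *: x).
Proof.
move=> [p hp ->]; exists ('X_[m] * p); last by rewrite scale_quot_pi.
move=> m'; rewrite mulrC (perm_mem (msuppMX _ _)) => /mapP[q /hp <- ->].
by apply/ffunP => i; rewrite !ffunE mnmDE PoszD.
Qed.

Lemma multideg_inj : injective multideg.
Proof. by move=> m p /ffunP e; apply/mnmP => i; have := e i; rewrite !ffunE => -[]. Qed.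

Lemma quot_comp_span x :
  exists (s : seq {ffun 'I_n -> int}) (y : _ -> quot_ideal monomial_gens),
    (forall a, quot_comp a (y a)) /\ x = \sum_(a <- s) y a.
Proof.
have [p ->] := quot_piP x.
pose q a : S := \sum_(m <- msupp p | multideg m == a) p@_m *: 'X_[m].
exists (map multideg (msupp p)), (fun a => quot_pi monomial_gens (q a)); split.
  move=> a; exists (q a) => // m /msupp_sum_le /flattenP[/= s /mapP[m']].
  rewrite mem_filter => /andP[/eqP e _] -> /msuppZ_le.
  by rewrite msuppX mem_seq1 => /eqP ->.
rewrite -(big_morph _ (@quot_piD _ monomial_gens) (quot_pi0 _)); congr quot_pi.
rewrite big_map {1}[p]mpolyE; apply: eq_big_seq => m hm.
rewrite /q -big_filter (_ : filter _ _ = [:: m]) ?big_seq1 //.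
rewrite -(filter_pred1_uniq (msupp_uniq p) hm); apply: eq_filter => m' /=.
by rewrite (inj_eq multideg_inj).
Qed.

Lemma quot_comp_indep (s : seq {ffun 'I_n -> int})
    (y : _ -> quot_ideal monomial_gens) :
  uniq s -> (forall a, quot_comp a (y a)) -> \sum_(a <- s) y a = 0 ->
  forall a, a \in s -> y a = 0.
Proof.
move=> us hy; have /choice[q hq] a : exists q : S,
    (forall m, m \in msupp q -> multideg m = a) /\
    y a = quot_pi monomial_gens q by have [q] := hy a; exists q.
rewrite (eq_bigr (fun a => quot_pi monomial_gens (q a))); last first.
  by move=> a _; have [] := hq a.
rewrite -(big_morph _ (@quot_piD _ monomial_gens) (quot_pi0 _)).
move/eqP; rewrite -(quot_pi0 monomial_gens) quot_pi_eq subr0.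
move=> /mem_monomial_ideal h a sa; have [qa ->] := hq a.
apply/eqP; rewrite quot_pi_eq subr0; apply/mem_monomial_ideal => m hm.
apply: h; rewrite mcoeff_msupp raddf_sum /= (bigD1_seq a) //=.
rewrite big1_seq ?addr0 -?mcoeff_msupp // => b /andP[ba _].
apply: memN_msupp_eq0; apply: contra ba => hb.
by rewrite -((hq b).1 m hb) (qa m hm).
Qed.

Definition quot_grading : zn_grading (quot_ideal monomial_gens) :=
  ZnGrading quot_comp0 quot_comp_lin quot_compM quot_comp_span quot_comp_indep.

End MonomialQuotient.
End StanleyDepth.

(* Vertices are shifted to 0, ..., n-1; only differences matter. When n < k the truncated n - k is 0, which is harmless since
   j - i <= k then holds for all i < j. *)
Definition cycle_power (n k : nat) : rel 'I_n := fun i j =>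
  let adj (a b : 'I_n) :=
    (a < b)%N && ((b - a <= k)%N || (n - k <= b - a)%N) in
  adj i j || adj j i.

(* Exponents of the monomials x_i x_j, {i, j} an edge *)
Definition edge_monomials (n : nat) (e : rel 'I_n) : seq 'X_{1..n} :=
  [seq (U_(ij.1) + U_(ij.2))%MM | ij <- enum [pred ij : 'I_n * 'I_n | e ij.1 ij.2]].

Lemma edge_gensE (K : fieldType) (n : nat) (e : rel 'I_n) :
  monomial_gens K (edge_monomials e) =
  [seq 'X_ij.1 * 'X_ij.2 | ij <- enum [pred ij : 'I_n * 'I_n | e ij.1 ij.2]].
Proof.
by rewrite /monomial_gens -map_comp; apply: eq_map => ij /=; rewrite mpolyXD.
Qed.

(* sdepth (S / I(e)) *)
Definition sdepth_edge (K : fieldType) (n : nat) (e : rel 'I_n) : nat :=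
  sdepth (quot_grading K (edge_monomials e)).

(* Main.v *)
(* If the independence complex of a graph is a disjoint union of intervals
   [F, G], then S/I is the direct sum of the spaces x_F K[G], so the Stanley
   depth is at least the smallest #|G|.  Such partitions are built by splitting
   the complex along a vertex v: the faces avoiding v form the complex of G - v,
   those containing v are v joined with the faces of the complex of G - N[v],
   and an isolated v can be added to all the tops.  On the power of a path with
   m vertices this yields the bound by induction from m - 2k - 1 vertices;
   removing the last k vertices of the cycle one at a time reduces to paths.
   For the complete graph every x_i x_j with i != j annihilates S/I, so no
   nonzero free Stanley space involves two variables. *)
Require Import Defs.
From mathcomp Require Import all_boot all_order all_algebra.
From mathcomp Require Import boolp zify.

Set Implicit Arguments.
Unset Strict Implicit.
Unset Printing Implicit Defensive.

Import Order.TTheory GRing.Theory Num.Theory.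

Local Open Scope ring_scope.

(** * Interval partitions of the independence complex of a graph *)

Section IndependencePartition.
Variables (I : finType) (e : rel I).
Hypotheses (e_sym : symmetric e) (e_irr : irreflexive e).
Local Open Scope nat_scope.

Definition independent (T : {set I}) : bool :=
  [forall i in T, forall j in T, ~~ e i j].

Definition in_interval (T : {set I}) (p : {set I} * {set I}) : bool :=
  (p.1 \subset T) && (T \subset p.2).

(* The independence complex of the subgraph induced on V is a disjoint union of
   intervals [F, G] with #|G| >= d. *)
Definition interval_partition (V : {set I}) (d : nat) : Prop :=
  exists2 s : seq ({set I} * {set I}),
    all (fun p : {set I} * {set I} => (p.1 \subset p.2) && (d <= #|p.2|)) s &
    forall T, count (in_interval T) s = (T \subset V) && independent T.

Lemma independentP (T : {set I}) :
  reflect {in T &, forall i j, ~~ e i j} (independent T).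
Proof.
apply: (iffP forall_inP) => [h i j iT jT|h i iT].
  by have /forall_inP := h i iT; apply.
by apply/forall_inP => j jT; apply: h.
Qed.

Lemma independentU1 v T :
  independent (v |: T) = independent T && [disjoint T & e v].
Proof.
apply/independentP/andP => [h|[/independentP h dis] i j].
  split; first by apply/independentP => i j iT jT; apply: h; rewrite !inE ?iT ?jT orbT.
  rewrite disjoint_subset; apply/subsetP => i iT.
  by apply: h; rewrite !inE ?eqxx ?iT ?orbT.
have nev x : x \in T -> ~~ e v x.
  by move=> xT; have := disjointFr dis xT; rewrite -topredE /= => ->.
rewrite !inE => /orP[/eqP->|iT] /orP[/eqP->|jT]; rewrite ?e_irr //; try exact: nev.
  by rewrite e_sym nev.
exact: h.
Qed.

(** A nonempty interval contains its own top, which is therefore counted and must be a face. *)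
Lemma interval_top (V : {set I}) (s : seq ({set I} * {set I})) (p : {set I} * {set I}) :
  (forall T, count (in_interval T) s = (T \subset V) && independent T) ->
  p \in s -> p.1 \subset p.2 -> (p.2 \subset V) && independent p.2.
Proof.
move=> cs ps pp; have: 0 < count (in_interval p.2) s.
  by rewrite -has_count; apply/hasP; exists p; rewrite // /in_interval pp subxx.
by rewrite cs lt0b.
Qed.

Lemma interval_partition0 V : interval_partition V 0.
Proof.
exists [seq (T, T) | T <- enum [pred T : {set I} | (T \subset V) && independent T]].
  by apply/allP => p /mapP[T _ ->] /=; rewrite subxx.
move=> T; rewrite count_map (eq_count (a2 := pred1 T)); last first.
  by move=> T'; rewrite /in_interval /= -eqEsubset.
by rewrite count_uniq_mem ?enum_uniq // mem_enum inE.
Qed.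

Lemma in_intervalU1 v T (p : {set I} * {set I}) :
  p.1 \subset p.2 -> v \notin p.1 ->
  in_interval T (v |: p.1, v |: p.2) = (v \in T) && in_interval (T :\ v) p.
Proof.
move=> Fsub vF; rewrite /in_interval /= subUset sub1set -andbA; case vT: (v \in T) => //=.
by rewrite subsetD1 vF andbT subDset.
Qed.

(* The faces containing v and those avoiding v are partitioned separately. *)
Lemma interval_partition_vertex v (V : {set I}) d : v \in V ->
  interval_partition (V :\ v) d.+1 ->
  interval_partition (V :\ v :\: [set i | e v i]) d ->
  interval_partition V d.+1.
Proof.
move=> vV [s1 /allP as1 cs1] [s2 /allP as2 cs2].
have vs2 (p : {set I} * {set I}) : p \in s2 -> v \notin p.2.
  move=> ps2; have /andP[sub _] := interval_top cs2 ps2 (proj1 (andP (as2 p ps2))).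
  by apply/negP => /(subsetP sub); rewrite !inE eqxx andbF.
exists (s1 ++ [seq (v |: p.1, v |: p.2) | p : {set I} * {set I} <- s2]).
  rewrite all_cat; apply/andP; split; apply/allP => // q /mapP[p ps2 ->] /=.
  have /andP[/= pp dp] := as2 p ps2.
  by rewrite setUS // cardsU1 (vs2 p ps2) add1n ltnS.
move=> T; rewrite count_cat cs1 count_map.
rewrite (eq_in_count (a2 := fun p => (v \in T) && in_interval (T :\ v) p)); last first.
  move=> p ps2; have /andP[/= pp _] := as2 p ps2; rewrite in_intervalU1 //.
  by apply: contra (vs2 p ps2); apply/subsetP.
case: (boolP (v \in T)) => vT; last first.
  by rewrite (eq_count (a2 := pred0)) // count_pred0 addn0 subsetD1 vT andbT.
rewrite (eq_count (a2 := in_interval (T :\ v))) // cs2 subsetD1 vT andbF add0n.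
have -> : (T \subset V) = (T :\ v \subset V).
  by rewrite -{1}(setD1K vT) subUset sub1set vV.
have -> : independent T = independent (T :\ v) && [disjoint T :\ v & e v].
  by rewrite -{1}(setD1K vT) independentU1.
have <- : [disjoint T :\ v & [set i | e v i]] = [disjoint T :\ v & e v].
  by apply: eq_disjoint_r => i; rewrite inE.
by rewrite subsetD subsetD1 !inE eqxx andbT -andbA [_ && independent _]andbC.
Qed.

(** For [T] inside [V], [T] and [T :\ v] are faces together, so raising only the tops by [v] makes
    each interval cover both. *)
Lemma interval_partition_isolated v (V : {set I}) d : v \in V ->
  {in V, forall i, ~~ e v i} ->
  interval_partition (V :\ v) d -> interval_partition V d.+1.
Proof.
move=> vV isol [s /allP ivs cs].
have vs (p : {set I} * {set I}) : p \in s -> v \notin p.2.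
  move=> ps; have /andP[sub _] := interval_top cs ps (proj1 (andP (ivs p ps))).
  by apply/negP => /(subsetP sub); rewrite !inE eqxx.
exists [seq (p.1, v |: p.2) | p : {set I} * {set I} <- s].
  apply/allP => // q /mapP[p ps ->] /=; have /andP[/= pp dp] := ivs p ps.
  by rewrite subsetU ?pp ?orbT // cardsU1 (vs p ps) add1n ltnS.
move=> T; rewrite count_map (eq_in_count (a2 := in_interval (T :\ v))); last first.
  move=> p ps; have /andP[/= pp _] := ivs p ps; rewrite /in_interval /= subDset subsetD1.
  by rewrite (contra _ (vs p ps)) ?andbT //; apply/subsetP.
rewrite cs subsetD1 !inE eqxx andbT subDset setUC; congr nat_of_bool.
have -> : V :|: [set v] = V by apply/setUidPl; rewrite sub1set.
case: (boolP (T \subset V)) => //= TV.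
case: (boolP (v \in T)) => vT; last first.
  by congr independent; apply/setDidPl; rewrite disjoint_sym disjoints1.
rewrite -[in RHS](setD1K vT) independentU1; case: (independent _) => //=.
apply/esym; rewrite disjoint_subset; apply/subsetP => i /setD1P[_ iT].
exact: (isol i (subsetP TV i iT)).
Qed.

(** Splitting along any vertex asks only the trivial bound 0 of the faces containing it, and the
    last vertex left is isolated. *)
Lemma interval_partition1 (V : {set I}) : V != set0 -> interval_partition V 1.
Proof.
elim/ltn_ind: {V}#|V| {-2}V (erefl #|V|) => m IH V cV /set0Pn[v vV].
case: (eqVneq (V :\ v) set0) => [V0|Vn0].
  apply: (interval_partition_isolated vV) (interval_partition0 _) => i iV.
  case: (eqVneq i v) => [->|iv]; first by rewrite e_irr.
  by have := in_set0 i; rewrite -V0 !inE iv iV.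
apply: (interval_partition_vertex vV) (interval_partition0 _).
by apply: (IH #|V :\ v|) => //; rewrite -cV (cardsD1 v V) vV.
Qed.

End IndependencePartition.

(** * Arcs of the cycle and the graphs they induce *)

Section CyclePower.
Variables n k : nat.
Local Open Scope nat_scope.
Local Notation e := (@cycle_power n k).

Lemma cycle_power_sym : symmetric e.
Proof. by move=> i j; rewrite /cycle_power orbC. Qed.

Lemma cycle_power_irr : irreflexive e.
Proof. by move=> i; rewrite /cycle_power ltnn. Qed.

Definition arc (a b : nat) : {set 'I_n} := [set i : 'I_n | a <= i < b].

(* The vertices a+j, ..., a+1 are removed in turn; once all neighbours of a are
   gone, a is isolated.  Each closed neighbourhood met on the way lies below
   a + 2k + 1. *)
Lemma interval_partition_arc d a b : b <= n -> b <= a + (n - k) ->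
  d * (2 * k + 1) + a < b + (2 * k + 1) -> interval_partition e (arc a b) d.
Proof.
(* The bound [b <= a + (n - k)] rules out wrap-around edges, so the arc induces a path power; [dab]
   says that [d] is at most (b - a) / (2k + 1) rounded up. *)
elim: d a => [|d IH] a bn ban dab; first exact: interval_partition0.
have an : a < n by nia.
pose v0 := Ordinal an.
(* [V j] is the arc without a+j+1, ..., a+k: the whole arc for j = k, and with a isolated for j =
   0. *)
pose V j : {set 'I_n} :=
  [set i : 'I_n | ((a <= i <= a + j) || (a + k < i)) && (i < b)].
have -> : arc a b = V k.
  by apply/setP => i; rewrite !inE; lia.
suff step j : j <= k -> interval_partition e (V j) d.+1 by apply: step.
elim: j => [|j IHj] jk.
  apply: (@interval_partition_isolated _ e cycle_power_sym cycle_power_irr v0).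
  - by rewrite !inE /=; nia.
  - by move=> i; rewrite !inE /cycle_power /=; lia.
  - have -> : V 0 :\ v0 = arc (a + k + 1) b.
      by apply/setP => i; rewrite !inE -val_eqE /=; lia.
    by apply: IH => //; nia.
(* A short arc may end before a+j+1, and then there is nothing to remove. *)
have [ltb|geb] := ltnP (a + j.+1) b; last first.
  have -> : V j.+1 = V j by apply/setP => i; rewrite !inE; lia.
  by apply: IHj; lia.
have vn : a + j.+1 < n by lia.
pose v := Ordinal vn.
apply: (@interval_partition_vertex _ e cycle_power_sym cycle_power_irr v).
- by rewrite !inE /=; lia.
- have -> : V j.+1 :\ v = V j by apply/setP => i; rewrite !inE -val_eqE /=; lia.
  by apply: IHj; lia.
- have -> : V j.+1 :\ v :\: [set i | e v i] = arc (a + j.+1 + k + 1) b.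
    by apply/setP => i; rewrite !inE -val_eqE /cycle_power /=; have := ltn_ord i; lia.
  by apply: IH => //; nia.
Qed.

(** The first n-k vertices span no wrap-around edge, and on them the bound for arcs reads exactly
    d(2k+1) <= n+k. The other k vertices are put back one at a time. *)
Lemma interval_partition_cycle d : 2 * k + 2 <= n -> d * (2 * k + 1) <= n + k ->
  interval_partition e [set: 'I_n] d.
Proof.
move=> nk dn; have -> : [set: 'I_n] = arc 0 (n - k + k).
  by apply/setP => i; rewrite !inE /=; have := ltn_ord i; lia.
suff step j : j <= k -> interval_partition e (arc 0 (n - k + j)) d by apply: step.
elim: j => [|j IHj] jk.
  by apply: interval_partition_arc; nia.
have vn : n - k + j < n by lia.
pose v := Ordinal vn.
case: d dn IHj => [|d] dn IHj; first exact: interval_partition0.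
apply: (@interval_partition_vertex _ e cycle_power_sym cycle_power_irr v).
- by rewrite !inE /=; lia.
- have -> : arc 0 (n - k + j.+1) :\ v = arc 0 (n - k + j).
    by apply/setP => i; rewrite !inE -val_eqE /=; lia.
  by apply: IHj; lia.
(* The neighbours of [v] are 0, ..., j, by wrap-around, and the k vertices just before [v]; the
   n-2k-1 vertices left form a path power. *)
- have -> : arc 0 (n - k + j.+1) :\ v :\: [set i | e v i]
            = arc (j + 1) (n - k + j - k).
    by apply/setP => i; rewrite !inE -val_eqE /cycle_power /=; have := ltn_ord i; lia.
  by apply: interval_partition_arc; nia.
Qed.

Lemma cycle_power_complete i j : n <= 2 * k + 1 -> i != j -> e i j.
Proof. by rewrite -val_eqE /cycle_power /=; lia. Qed.

End CyclePower.

(** * From interval partitions to Stanley decompositions *)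

Section StanleyOfIntervals.
Variables (K : fieldType) (n : nat) (e : rel 'I_n).
Hypothesis e_irr : irreflexive e.
Local Notation S := {mpoly K[n]}.
Local Notation ms := (edge_monomials e).
Local Notation gens := (monomial_gens K ms).
Local Notation M := (quot_ideal gens).

Definition monomial_support (m : 'X_{1..n}) : {set 'I_n} :=
  [set i | m i != 0%N].

Definition indicator (F : {set 'I_n}) : 'X_{1..n} :=
  [multinom (i \in F : nat) | i < n].

Lemma monomial_supportD m m' :
  monomial_support (m + m')%MM = monomial_support m :|: monomial_support m'.
Proof. by apply/setP => i; rewrite !inE mnmDE addn_eq0 negb_and. Qed.

Lemma monomial_support_indicator F : monomial_support (indicator F) = F.
Proof. by apply/setP => i; rewrite !inE mnmE; case: (i \in F). Qed.

Lemma indicator_le (F : {set 'I_n}) m : F \subset monomial_support m -> (indicator F <= m)%MM.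
Proof.
move=> /subsetP sub; apply/mnm_lepP => i; rewrite mnmE.
by case: (boolP (i \in F)) => // /sub; rewrite inE lt0n.
Qed.

Lemma subpolyP (W : {set 'I_n}) (p : S) :
  reflect {in msupp p, forall m, monomial_support m \subset W} (p \in subpoly W).
Proof.
apply: (iffP allP) => h m /h => [/forallP hm|/subsetP hm].
  by apply/subsetP => i; rewrite inE; apply: contraR => iW; have /implyP := hm i; apply.
by apply/forallP => i; apply/implyP; apply: contraR => mi; apply: hm; rewrite inE.
Qed.

Lemma edge_monomial_dvd m g :
  g \in ms -> (g <= m)%MM -> ~~ independent e (monomial_support m).
Proof.
case/mapP => -[i j]; rewrite mem_enum inE /= => eij -> /mnm_lepP le.
apply/negP => /independentP/(_ i j); rewrite eij !inE => h.
have := le i; have := le j; rewrite !mnmDE !mnm1E !eqxx => lj li.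
by apply: notF; apply: h; lia.
Qed.

(** Without loops the generators are squarefree, so divisibility by one of them depends only on the
    support of [m]. *)
Lemma edge_monomial_exists m : ~~ independent e (monomial_support m) ->
  exists2 g, g \in ms & (g <= m)%MM.
Proof.
rewrite negb_forall_in => /exists_inP[i im].
rewrite negb_forall_in => /exists_inP[j jm]; rewrite negbK => eij.
exists (U_(i) + U_(j))%MM.
  by apply/mapP; exists (i, j) => //; rewrite mem_enum inE.
have ij : i != j by apply: contraTneq eij => ->; rewrite e_irr.
move: im jm; rewrite !inE => im jm; apply/mnm_lepP => l; rewrite mnmDE !mnm1E.
case: (eqVneq i l) => [il|_]; case: (eqVneq j l) => [jl|_] //.
- by rewrite il jl eqxx in ij.
- by rewrite addn0 lt0n -il.
- by rewrite add0n lt0n -jl.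
Qed.

(** Every monomial of an element of I is divisible by a generator, so the monomials with independent
    support stay linearly independent in S/I. *)
Lemma quot_pi_eq0 (q : S) :
  {in msupp q, forall m, independent e (monomial_support m)} ->
  quot_pi gens q = 0 -> q = 0.
Proof.
move=> ind /eqP; rewrite -quot_pi0 quot_pi_eq subr0 => /mem_monomial_ideal h.
apply/eqP; rewrite -msupp_eq0; case E: (msupp q) => [//|m s].
have mq : m \in msupp q by rewrite E mem_head.
by have [g gms /(edge_monomial_dvd gms)] := h m mq; rewrite ind.
Qed.

Definition mrestrict (P : pred 'X_{1..n}) (q : S) : S :=
  \sum_(m <- msupp q | P m) q@_m *: 'X_[m].

Lemma mcoeff_mrestrict P q m : (mrestrict P q)@_m = q@_m *+ P m.
Proof.
rewrite /mrestrict raddf_sum /=.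
rewrite (eq_bigr (fun m' => q@_m' * (m' == m)%:R)); last first.
  by move=> m' _; rewrite mcoeffZ mcoeffX.
case: (boolP (m \in msupp q)) => mq; last first.
  rewrite (memN_msupp_eq0 mq) mul0rn big1_seq // => m' /andP[_ m'q].
  by case: eqVneq => [m'm|_]; rewrite ?mulr0 //; rewrite -m'm m'q in mq.
rewrite big_mkcond (bigD1_seq m) ?msupp_uniq //= eqxx mulr1 big1 ?addr0.
  by case: (P m).
by move=> m' /negPf ->; rewrite mulr0 if_same.
Qed.

(** For the converse each monomial of [q] is divided by x_F, which leaves a monomial in the
    variables of [G]. *)
Lemma stanley_space_intervalP (F G : {set 'I_n}) (x : M) : F \subset G ->
  stanley_space (quot_pi gens 'X_[indicator F]) G x <->
  exists2 q : S, {in msupp q, forall m, in_interval (monomial_support m) (F, G)} &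
    x = quot_pi gens q.
Proof.
move=> FG; split=> [[p /subpolyP pG ->]|[q qFG ->]].
  exists (p * 'X_[indicator F]); last exact: scale_quot_pi.
  move=> m; rewrite (perm_mem (msuppMX _ _)) => /mapP[m' /pG m'G ->].
  rewrite /in_interval monomial_supportD monomial_support_indicator /=.
  by rewrite subsetUl subUset FG.
pose p : S := \sum_(m <- msupp q) q@_m *: 'X_[m - indicator F].
exists p.
  apply/subpolyP => m /msupp_sum_le /flattenP[/= s /mapP[m']].
  rewrite filter_predT => m'q -> /msuppZ_le; rewrite msuppX mem_seq1 => /eqP ->.
  have /andP[_ /= m'G] := qFG m' m'q; apply: subset_trans m'G.
  by apply/subsetP => i; rewrite !inE mnmBE; lia.
rewrite scale_quot_pi; congr quot_pi; rewrite {1}[q]mpolyE /p mulr_suml.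
apply: eq_big_seq => m mq; rewrite -scalerAl -mpolyXD submK //.
by apply: indicator_le; have /andP[] := qFG m mq.
Qed.

(** As [G] is independent, no monomial of x_F K[G] dies in S/I; since S is a domain, x_F cancels,
    and the generator alone is a basis. *)
Lemma stanley_space_interval_free (F G : {set 'I_n}) :
  F \subset G -> independent e G ->
  free_over G (stanley_space (quot_pi gens 'X_[indicator F]) G).
Proof.
move=> FG /independentP indG; pose v := quot_pi gens 'X_[indicator F].
exists 1%N, (fun=> v); split=> [_|x [p pG ->]].
  exists 1; last by rewrite scale1r.
  apply/subpolyP => m; rewrite msupp1 mem_seq1 => /eqP ->.
  by apply/subsetP => i; rewrite inE mnm0E.
exists [ffun=> p]; split=> [|c [cG]].
  by split=> [i|]; rewrite ?big_ord1 ffunE.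
rewrite big_ord1 => pc; apply/ffunP => i; rewrite ffunE ord1.
have /eqP : (p - c ord0) * 'X_[indicator F] = 0.
  apply: quot_pi_eq0; last by rewrite -scale_quot_pi scalerBl pc subrr.
  move=> m; rewrite (perm_mem (msuppMX _ _)) => /mapP[m' m'pc ->].
  have sub : F :|: monomial_support m' \subset G.
    rewrite subUset FG /=; move: m'pc => /msuppB_le; rewrite mem_cat => /orP[].
      exact: (subpolyP _ _ pG).
    exact: (subpolyP _ _ (cG ord0)).
  rewrite monomial_supportD monomial_support_indicator; apply/independentP => a b.
  by move=> /(subsetP sub) aG /(subsetP sub) bG; apply: indG.
rewrite mulf_eq0 subr_eq0 => /orP[/eqP //|/eqP/(congr1 (mcoeff (indicator F)))].
by rewrite mcoeffX eqxx mcoeff0 => /eqP; rewrite oner_eq0.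
Qed.

Lemma sum_in_interval (s : seq ({set 'I_n} * {set 'I_n})) T :
  (\sum_(i < size s) in_interval T (tnth (in_tuple s) i))%N = count (in_interval T) s.
Proof.
rewrite -sum1_count (big_tnth _ _ s) [RHS]big_mkcond /=.
by apply: eq_bigr => i _; case: in_interval.
Qed.

Lemma interval_stanley_decomposition d :
  interval_partition e [set: 'I_n] d ->
  exists D : stanley_decomposition (quot_grading K ms), (d <= sdepth_dec D)%N.
Proof.
case=> s /allP ivs cs; pose p i := tnth (in_tuple s) i.
have ps i : p i \in s by exact: mem_tnth.
have sub i : (p i).1 \subset (p i).2 by have /andP[] := ivs _ (ps i).
have ind i : independent e (p i).2 by have /andP[] := interval_top cs (ps i) (sub i).
have indm i m : in_interval (monomial_support m) (p i) -> independent e (monomial_support m).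
  case/andP => _ /subsetP mG; apply/independentP => a b /mG aG /mG bG.
  exact: (independentP _ _ (ind i)).
have sumT T : (\sum_i in_interval T (p i))%N = independent e T.
  by rewrite sum_in_interval cs subsetT.
have disj T i j : in_interval T (p i) -> in_interval T (p j) -> i = j.
  move=> Ti Tj; apply/eqP; apply: contraT => ij.
  have := sumT T; rewrite (bigD1 i) //= (bigD1 j) /=; last by rewrite eq_sym.
  by rewrite Ti Tj; case: independent.
pose v i : M := quot_pi gens 'X_[indicator (p i).1].
pose W i := (p i).2.
have hom i : homogeneous (quot_grading K ms) (v i).
  exists (multideg (indicator (p i).1)), 'X_[indicator (p i).1] => // m.
  by rewrite msuppX mem_seq1 => /eqP ->.
have fre i : free_over (W i) (stanley_space (v i) (W i)).
  exact: stanley_space_interval_free (sub i) (ind i).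
have dir x : exists! y : {ffun 'I_(size s) -> M},
    (forall i, stanley_space (v i) (W i) (y i)) /\ x = \sum_i y i.
  have [q ->] := quot_piP x.
  pose r i := mrestrict (fun m => in_interval (monomial_support m) (p i)) q.
  have rP i m : m \in msupp (r i) -> in_interval (monomial_support m) (p i).
    by rewrite mcoeff_msupp mcoeff_mrestrict; case: in_interval; rewrite ?eqxx.
  (* The monomials of [q] missed by all [r i] have dependent support and so lie in I. *)
  have qr : quot_pi gens q = quot_pi gens (\sum_i r i).
    apply/eqP; rewrite quot_pi_eq; apply/mem_monomial_ideal => m.
    rewrite mcoeff_msupp mcoeffB raddf_sum /=.
    under eq_bigr do rewrite mcoeff_mrestrict.
    rewrite sumrMnr sumT => nz; apply: edge_monomial_exists.
    by apply: contraNN nz => ->; rewrite subrr.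
  exists [ffun i => quot_pi gens (r i)]; split=> [|y [yW]].
    split=> [i|].
      by rewrite ffunE; apply/(stanley_space_intervalP _ (sub i)); exists (r i) => // m /rP.
    under eq_bigr do rewrite ffunE.
    by rewrite -(big_morph _ (@quot_piD _ gens) (quot_pi0 _)).
  have /choice[t tP] i : exists t : S,
      {in msupp t, forall m, in_interval (monomial_support m) (p i)} /\
      y i = quot_pi gens t.
    by have /(stanley_space_intervalP _ (sub i))[t ht ->] := yW i; exists t.
  move=> e1.
  (* Only monomials with independent support occur here, so vanishing in S/I gives vanishing in
     S. *)
  have ri_ti : \sum_i (r i - t i) = 0.
    apply: quot_pi_eq0; last first.
      apply/eqP; rewrite sumrB -(quot_pi0 gens) quot_pi_eq subr0 -quot_pi_eq -qr e1.
      rewrite (eq_bigr (fun i => quot_pi gens (t i))) => [|i _]; last exact: (tP i).2.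
      by rewrite -(big_morph _ (@quot_piD _ gens) (quot_pi0 _)).
    move=> m /msupp_sum_le /flattenP[/= l /mapP[i _ ->]] /msuppB_le.
    by rewrite mem_cat => /orP[/rP|/(tP i).1]; apply: indm.
  apply/ffunP => i; rewrite ffunE (tP i).2; congr quot_pi.
  (* The intervals are disjoint, so a monomial of [r i - t i] occurs in no other summand, and its
     coefficient is that of the zero sum. *)
  apply/mpolyP => m; apply/eqP; rewrite -subr_eq0 -mcoeffB; apply: contraT => nz.
  have mi : in_interval (monomial_support m) (p i).
    rewrite -mcoeff_msupp in nz; move: nz => /msuppB_le.
    by rewrite mem_cat => /orP[/rP|/(tP i).1].
  have := congr1 (mcoeff m) ri_ti; rewrite mcoeff0 raddf_sum /= (bigD1 i) //= big1 ?addr0.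
    by move/eqP; rewrite (negPf nz).
  move=> j ji; apply/eqP; apply: contraR ji; rewrite -mcoeff_msupp => /msuppB_le.
  rewrite mem_cat => mj; apply/eqP; apply: disj mi.
  by case/orP: mj => [/rP|/(tP j).1].
exists (StanleyDecomposition hom fre dir); rewrite /sdepth_dec /= -minEnat -leEnat.
have dW i : (d <= #|W i|)%N by have /andP[] := ivs _ (ps i).
apply/bigmin_geP; split=> [|i _]; last by rewrite leEnat.
(* The minimum has default value n, so d <= n remains. The empty face lies in some interval, whose
   top has at least d and at most n elements. *)
have [i _] : exists i : 'I_(size s), true.
  apply/existsP; rewrite -[X in is_true X]negbK negb_exists; apply/negP => /forallP no.
  have := sumT set0; rewrite big1 => [|i]; last by have := no i.
  by have -> : independent e set0 by apply/independentP => a; rewrite inE.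
by rewrite leEnat (leq_trans (dW i)) // -[X in (_ <= X)%N](card_ord n) max_card.
Qed.

(** * Lower and upper bounds on the Stanley depth *)

Lemma sdepth_dec_le_size (M : lmodType S) (gr : zn_grading M)
    (D : stanley_decomposition gr) : (sdepth_dec D <= n)%N.
Proof. by rewrite /sdepth_dec -minEnat -leEnat; apply: bigmin_le_id. Qed.

Lemma sdepth_dec_le_sdepth (M : lmodType S) (gr : zn_grading M)
    (D : stanley_decomposition gr) : (sdepth_dec D <= sdepth gr)%N.
Proof.
have lt : (sdepth_dec D < n.+1)%N by rewrite ltnS sdepth_dec_le_size.
apply: (@leq_bigmax_cond _ _ (fun i : 'I_n.+1 => nat_of_ord i) (Ordinal lt)).
by apply/asboolP; exists D.
Qed.

Lemma interval_partition_sdepth d :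
  interval_partition e [set: 'I_n] d -> (d <= sdepth_edge K e)%N.
Proof.
by case/interval_stanley_decomposition => D /leq_trans; apply; apply: sdepth_dec_le_sdepth.
Qed.

Lemma sdepth_complete_le1 : (forall i j, i != j -> e i j) -> (sdepth_edge K e <= 1)%N.
Proof.
move=> cpl; apply/bigmax_leqP => d /asboolP[D <-].
(* If all generators vanished, S/I would be zero, but 1 is not in I. *)
have [i vi] : exists i : 'I_(sd_size D), sd_gen i != 0.
  apply/existsP; rewrite -[X in is_true X]negbK negb_exists; apply/negP => /forallP all0.
  have [y [[yW one] _]] := sd_direct D (quot_pi gens 1).
  have one0 : quot_pi gens 1 = 0.
    rewrite one big1 // => i _; have [p _ ->] := yW i.
    by have := all0 i; rewrite negbK => /eqP ->; rewrite scaler0.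
  suff /eqP : 1 = 0 :> S by rewrite oner_eq0.
  apply: quot_pi_eq0 one0 => m; rewrite msupp1 mem_seq1 => /eqP ->; apply/independentP => a b.
  by rewrite inE mnm0E.
have : (#|sd_vars i| <= 1)%N; last first.
  by apply: leq_trans; rewrite /sdepth_dec -minEnat -leEnat; apply: bigmin_le.
rewrite leqNgt; apply/negP => /card_gt1P[a [b [aW bW ab]]].
(* The basis need not consist of the generator; an empty one would make the generator zero. *)
have [[|r] [c [cN basis]]] := sd_free i.
  have [|z [[_ z0] _]] := basis (sd_gen i).
    exists 1; rewrite ?scale1r //; apply/subpolyP => m.
    by rewrite msupp1 mem_seq1 => /eqP ->; apply/subsetP => l; rewrite inE mnm0E.
  by rewrite z0 big_ord0 eqxx in vi.
pose u := (U_(a) + U_(b))%MM.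
have kill : 'X_[u] *: sd_gen i = 0.
  have [q ->] := quot_piP (sd_gen i); rewrite scale_quot_pi -(quot_pi0 gens).
  apply/eqP; rewrite quot_pi_eq subr0 mulrC; apply/mem_monomial_ideal => m.
  rewrite (perm_mem (msuppMX _ _)) => /mapP[m' _ ->].
  exists u; last exact: lem_addr.
  by apply/mapP; exists (a, b) => //; rewrite mem_enum inE /= cpl.
have [p _ cp] := cN ord0.
have killc : 'X_[u] *: c ord0 = 0 by rewrite cp scalerA mulrC -scalerA kill scaler0.
(* Zero gets two coordinate vectors, the zero one and x_a x_b at the first basis element, against
   uniqueness. *)
have [|z [_ uniq]] := basis 0.
  by exists 0; rewrite ?scale0r //; apply/subpolyP => m; rewrite msupp0.
have z0 : z = [ffun=> 0].
  apply: uniq; split=> [j|]; first by rewrite ffunE; apply/subpolyP => m; rewrite msupp0.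
  by rewrite big1 // => j _; rewrite ffunE scale0r.
have : z = [ffun j => if j == ord0 then 'X_[u] else 0].
  apply: uniq; split=> [j|].
    rewrite ffunE; case: eqP => _; apply/subpolyP => m; rewrite ?msupp0 //.
    rewrite msuppX mem_seq1 => /eqP ->; rewrite /u monomial_supportD subUset.
    apply/andP; split; apply/subsetP => l; rewrite inE mnm1E.
      by case: (a =P l) => // <-.
    by case: (b =P l) => // <-.
  rewrite (bigD1 ord0) //= ffunE eqxx killc add0r big1 // => j /negPf j0.
  by rewrite ffunE j0 scale0r.
rewrite z0 => /ffunP/(_ ord0); rewrite !ffunE eqxx => /(congr1 (mcoeff u)).
by rewrite mcoeffX eqxx mcoeff0 => /eqP; rewrite eq_sym oner_eq0.
Qed.

End StanleyOfIntervals.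

Theorem theorem4p6 (K : fieldType) (n k : nat) (hk : (1 <= k)%N) (hn : (3 <= n)%N) :
  ((n <= 2 * k + 1)%N -> sdepth_edge K (@cycle_power n k) = 1%N) /\
  ((2 * k + 2 <= n)%N ->
     Num.ceil ((n%:R - k%:R) / (2 * k + 1)%:R : rat) <=
       (sdepth_edge K (@cycle_power n k))%:Z).
Proof.
have irr := @cycle_power_irr n k; have sym := @cycle_power_sym n k.
split=> hnk.
  apply/eqP; rewrite eqn_leq sdepth_complete_le1 //=; last first.
    by move=> i j; apply: cycle_power_complete.
  apply: interval_partition_sdepth => //; apply: interval_partition1 => //.
  by apply/set0Pn; exists (Ordinal (ltnW (ltnW hn))); rewrite inE.
(* As n+k = (n-k) + 2k, this floor is the ceiling of (n-k)/(2k+1). *)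
pose d := ((n + k) %/ (2 * k + 1))%N.
have /(interval_partition_sdepth K irr) dle : interval_partition (@cycle_power n k) [set: _] d.
  by apply: interval_partition_cycle => //; apply: leq_divM.
rewrite ceil_le_int ler_pdivrMr ?ltr0n ?addn1 // lerBlDr -!natrM -natrD ler_nat.
have := divn_eq (n + k) (2 * k + 1); have := ltn_pmod (n + k) (isT : 0 < (2 * k).+1)%N.
rewrite -/d; nia.
Qed.
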